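(* Let $\Gamma$ be a discrete group with identity $e$, and let $\omega : \Gamma \to (0,\infty)$ be a weight function, i.e. $\omega(xy) \le \omega(x)\omega(y)$ for all $x,y\in\Gamma$. Suppose that the weighted group $(\Gamma,\omega)$ is directly finite. Let $f : \Gamma \to \mathbb{C}$ satisfy $\sum_{x\in\Gamma} |f(x)|\,\omega(x) < \infty$, and let $\rho^\omega_f : \ell^\infty(\Gamma) \to \ell^\infty(\Gamma)$ be the operator $$\rho^\omega_f(g)(x) = \sum_{y\in\Gamma} \frac{\omega(xy)}{\omega(x)}\, g(xy) f(y) \qquad (g\in\ell^\infty(\Gamma),\ x\in\Gamma).$$ Then the following are equivalent: (i) $\rho^\omega_f$ is injective; (ii) $\rho^\omega_f$ is bijective; (iii) $f$ is invertible in $\ell^1(\Gamma,\omega)$, i.e. there exists $g : \Gamma \to \mathbb{C}$ with $\sum_{x\in\Gamma} |g(x)|\,\omega(x) < \infty$ such that $f*g = \delta_e = g*f$.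
   Context: $\ell^\infty(\Gamma)$ is the Banach space of bounded functions $\Gamma\to\mathbb{C}$ with the supremum norm. $\ell^1(\Gamma,\omega)$ is the unital Banach algebra of all functions $a : \Gamma \to \mathbb{C}$ with $\sum_{x \in \Gamma} |a(x)|\,\omega(x) < \infty$, with convolution product $(a*b)(z) = \sum_{y\in\Gamma} a(zy^{-1}) b(y)$ and unit $\delta_e$ (the indicator function of $\{e\}$). The weighted group $(\Gamma,\omega)$ is called directly finite if the algebra $\ell^1(\Gamma,\omega)$ is directly finite, meaning that whenever $a,b \in \ell^1(\Gamma,\omega)$ satisfy $a*b=\delta_e$ they also satisfy $b*a=\delta_e$. *)

(* Defs.v *)
From mathcomp Require Import all_boot all_order all_algebra.
From mathcomp Require Import complex.
From mathcomp Require Import boolp classical_sets functions.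
From mathcomp Require Import reals ereal topology normedtype esum.
From mathcomp Require analysis.showcase.summability.

Set Implicit Arguments.
Unset Strict Implicit.
Unset Printing Implicit Defensive.

Import Order.TTheory GRing.Theory Num.Theory.
(* [normc z : R] is the modulus of [z : R[i]]; the generic [`|z|] is in [R[i]]. *)
Export ComplexField.Normc.

Local Open Scope classical_set_scope.
Local Open Scope ring_scope.
Local Open Scope complex_scope.

(* The unordered sum of a complex family: the limit, for the norm topology of
   [R[i]], of its partial sums along the directed set of finite subsets of [I].
   It is unspecified when this limit does not exist; the sums occurring below
   are absolutely convergent whenever [a, b, f] are in [l1 omega] and [g] is in
   [linfty R G]. *)
Definition csum (R : realType) (I : choiceType) (u : I -> R[i]) : R[i] :=
  @summability.sum I R[i] R[i]^o u.

Section WeightedGroup.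
Variables (R : realType) (G : groupType).

Definition weight (omega : G -> R) : Prop :=
  (forall x, 0 < omega x) /\
  (forall x y, omega (x * y)%g <= omega x * omega y).

Definition linfty : set (G -> R[i]) :=
  [set g | exists M : R, forall x, normc (g x) <= M].

Definition l1 (omega : G -> R) : set (G -> R[i]) :=
  [set a | (\esum_(x in [set: G]) (normc (a x) * omega x)%:E < +oo)%E].

Definition conv (a b : G -> R[i]) : G -> R[i] :=
  fun z => csum (fun y => a (z * y^-1)%g * b y).

Definition delta1 : G -> R[i] := fun x => (x == 1%g)%:R.

Definition directly_finite (omega : G -> R) : Prop :=
  forall a b, l1 omega a -> l1 omega b ->
    conv a b = delta1 -> conv b a = delta1.

Definition l1_invertible (omega : G -> R) (f : G -> R[i]) : Prop :=
  exists2 g, l1 omega g & conv f g = delta1 /\ conv g f = delta1.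

(* For [f] in [l1 omega], [rho omega f] maps [linfty R G] to itself: at each
   [x] the series is dominated by [sum_y omega y * |g (x * y)| * |f y|]. *)
Definition rho (omega : G -> R) (f g : G -> R[i]) : G -> R[i] :=
  fun x => csum (fun y => (omega (x * y)%g / omega x)%:C * g (x * y)%g * f y).

End WeightedGroup.

Arguments linfty R G : clear implicits.
Arguments delta1 {R G}.

(* Main.v *)
Require Import Defs.
From mathcomp Require Import all_boot all_order all_algebra.
From mathcomp Require Import complex.
From mathcomp Require Import boolp classical_sets functions.
From mathcomp Require Import reals.
From mathcomp Require Import finmap lra ring cardinality fsbigop ereal.
From mathcomp Require Import normedtype sequences esum.
From mathcomp.analysis.showcase Require summability.

Import Order.TTheory GRing.Theory Num.Theory.

(* Multiplying by [omega] identifies [linfty] with the dual of [l1 omega], and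
   then [rho omega f] is the adjoint of right convolution [a |-> conv a f]. If
   [rho omega f] is injective, the Hahn-Banach theorem shows that the left ideal
   [{conv a f}] is dense; hence it meets the ball of radius 1 around [delta1],
   whose elements are invertible by the Neumann series, so [f] has a left
   inverse, and direct finiteness makes it two-sided. Conversely
   [f |-> rho omega f] is multiplicative, so an inverse of [f] yields an inverse
   of [rho omega f]. *)

(** * Hahn-Banach separation *)

(** The closure of the left ideal is never formed. If no [conv a f] lies within 1 of [delta1], the
    distance to the ideal is a sublinear functional with value at least 1 at [delta1], and a linear
    functional below it at once vanishes on the ideal and is bounded by the norm. The separation is
    carried out over the reals and the functional is complexified afterwards; the ideal is stable
    under multiplication by i, so the complexification vanishes on it too. Density of a left ideal
    only ever gives information about products with [f] on the right, hence a left inverse; the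
    other side must come from direct finiteness. The analytic obstacle is that [omega * g] is
    neither bounded nor in [l1 omega] in general, so associativity of convolution is proved under a
    growth bound on the first factor alone. *)

Section HahnBanach.
Local Open Scope classical_set_scope.
Local Open Scope ring_scope.
Context {R : realType} {V : lmodType R} (D : set V).
Hypothesis D0 : D 0.
Hypothesis DD : forall u v, D u -> D v -> D (u + v).
Hypothesis DZ : forall (t : R) u, D u -> D (t *: u).

(** Functionals are total on [V] but constrained only on the subspace [D], which will be [l1 omega]
    inside the space of all functions. Homogeneity is asked as an inequality for [t > 0]; using it
    for [t^-1] as well gives equality. *)
Definition sublinear (q : V -> R) : Prop :=
  (forall u v, D u -> D v -> q (u + v) <= q u + q v) /\
  (forall t u, D u -> 0 < t -> q (t *: u) <= t * q u).

Lemma sublinear0 q : sublinear q -> q 0 = 0.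
Proof.
move=> [_ qZ]; have h0 : (0 : R) < 2^-1 by rewrite invr_gt0.
have := qZ 2 0 D0 (ltr0Sn _ _); have := qZ _ 0 D0 h0.
by rewrite !scaler0 => h1 h2; lra.
Qed.

Lemma sublinearZ q : sublinear q -> forall t u, D u -> 0 <= t ->
  q (t *: u) = t * q u.
Proof.
move=> qS t u Du; rewrite le_eqVlt => /predU1P[<-|t0].
  by rewrite scale0r mul0r sublinear0.
apply/eqP; rewrite eq_le qS.2//= -ler_pdivlMl//.
have := qS.2 t^-1 (t *: u) (DZ t _ Du).
by rewrite scalerA mulVf ?gt_eqF// scale1r invr_gt0; exact.
Qed.

Lemma sublinear_ge q u : sublinear q -> D u -> - q (- u) <= q u.
Proof.
move=> qS Du; have := qS.1 u (- u) Du.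
rewrite subrr sublinear0// -scaleN1r => /(_ (DZ _ _ Du)).
by rewrite -lerBlDr sub0r.
Qed.

(* The largest sublinear functional below [q] whose value at [- v] is at most
   [- q v]; when [q] is minimal this forces additivity in the direction [v]. *)
Definition tilt (q : V -> R) (v u : V) : R :=
  inf [set q (u + t *: v) - t * q v | t in [set t | 0 <= t]].

Lemma tilt_le q v u t : sublinear q -> D v -> D u -> 0 <= t ->
  tilt q v u <= q (u + t *: v) - t * q v.
Proof.
move=> qS Dv Du t0; apply: ge_inf; last by exists t.
(* A lower bound, without which [inf] would be a default value: [s *: v = - u + (u + s *: v)] and
   subadditivity. *)
exists (- q (- u)) => _ [s s0 <-].
rewrite lerBrDr addrC -sublinearZ// lerBlDr addrC.
rewrite -{1}[s *: v](addKr u) -scaleN1r.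
by apply: qS.1; [exact: DZ|apply: DD => //; exact: DZ].
Qed.

Lemma le_tilt q v u x :
  (forall t, 0 <= t -> x <= q (u + t *: v) - t * q v) -> x <= tilt q v u.
Proof.
move=> H; apply: lb_le_inf; first by exists (q (u + 0 *: v) - 0 * q v), 0 => /=.
by move=> _ [t t0 <-]; exact: H.
Qed.

Lemma tilt_id q v u : sublinear q -> D v -> D u -> tilt q v u <= q u.
Proof.
move=> qS Dv Du; have := tilt_le _ _ _ 0 qS Dv Du (lexx _).
by rewrite scale0r addr0 mul0r subr0.
Qed.

Lemma tilt_sublinear q v : sublinear q -> D v -> sublinear (tilt q v).
Proof.
move=> qS Dv; split=> [u w Du Dw|t u Du t0].
- rewrite -lerBlDl; apply: le_tilt => s s0; rewrite lerBlDl -lerBlDr.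
  apply: le_tilt => r r0; rewrite lerBlDr.
  apply: le_trans (tilt_le _ _ _ _ qS Dv (DD _ _ Du Dw) (addr_ge0 r0 s0)) _.
  rewrite addrACA -opprD -mulrDl lerD2r scalerDl addrACA.
  by apply: qS.1; apply: DD => //; exact: DZ.
- rewrite -ler_pdivrMl//; apply: le_tilt => s s0; rewrite ler_pdivrMl//.
  apply: le_trans (tilt_le _ _ _ (t * s) qS Dv (DZ _ _ Du) _) _.
    by rewrite mulr_ge0// ltW.
  rewrite mulrBr mulrA lerD2r -scalerA -scalerDr.
  by apply: qS.2 => //; apply: DD => //; exact: DZ.
Qed.

(** Zorn's lemma for the reversed pointwise order on [D], a mere preorder because values off [D] are
    ignored. A nonempty chain is bounded by its pointwise infimum, which is finite since every
    member is at least [- p (- u)] at [u]. *)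
Lemma minimal_sublinear p : sublinear p -> exists q, [/\ sublinear q,
  forall u, D u -> q u <= p u & forall q', sublinear q' ->
    (forall u, D u -> q' u <= q u) -> forall u, D u -> q u <= q' u].
Proof.
move=> pS; pose T := {q | sublinear q /\ forall u, D u -> q u <= p u}.
pose rT (s t : T) := `[< forall u, D u -> sval t u <= sval s u >].
have t0 : T by exists p.
have [||A Atot|[q [qS qp]] qmin] := @ZL_preorder T t0 rT.
- by move=> t; apply/asboolP.
- move=> r s t /asboolP rs /asboolP st; apply/asboolP => u Du.
  exact: le_trans (st u Du) (rs u Du).
- have [[s0 As0]|A0] := pselect (exists s, A s); last first.
    by exists t0 => s As; case: A0; exists s.
  pose q u := inf [set sval s u | s in A].
  have qA s u : A s -> D u -> q u <= sval s u.
    move=> As Du; apply: ge_inf; last by exists s.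
    exists (- p (- u)) => _ [[r [rS rp]] Ar <-] /=.
    apply: le_trans (sublinear_ge _ _ rS Du).
    by rewrite lerN2 rp// -scaleN1r; exact: DZ.
  have leq x u : (forall s, A s -> x <= sval s u) -> x <= q u.
    move=> H; apply: lb_le_inf; first by exists (sval s0 u), s0.
    by move=> _ [s As <-]; exact: H.
  have qS : sublinear q.
    split=> [u v Du Dv|t u Du t_gt0].
    + rewrite -lerBlDl; apply: (leq _ v) => s As; rewrite lerBlDl -lerBlDr.
      apply: (leq _ u) => r Ar; rewrite lerBlDr.
      (* Totality of the chain: the smaller of [r] and [s] serves for both arguments. *)
      have [/asboolP rs|/asboolP sr] := Atot _ _ As Ar.
      * apply: le_trans (qA r _ Ar (DD _ _ Du Dv)) _.
        by apply: le_trans ((svalP r).1.1 _ _ Du Dv) _; rewrite lerD2l rs.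
      * apply: le_trans (qA s _ As (DD _ _ Du Dv)) _.
        by apply: le_trans ((svalP s).1.1 _ _ Du Dv) _; rewrite lerD2r sr.
    + rewrite -ler_pdivrMl//; apply: leq => s As; rewrite ler_pdivrMl//.
      exact: le_trans (qA s _ As (DZ _ _ Du)) ((svalP s).1.2 _ _ Du t_gt0).
  have qp u : D u -> q u <= p u.
    by move=> Du; apply: le_trans (qA _ _ As0 Du) ((svalP s0).2 _ Du).
  exists (exist _ q (conj qS qp)) => s As; apply/asboolP => u Du /=.
  exact: qA.
exists q; split=> // q' q'S q'q u Du.
have q'p w : D w -> q' w <= p w.
  by move=> Dw; exact: le_trans (q'q _ Dw) (qp _ Dw).
have /asboolP := qmin (exist _ q' (conj q'S q'p)) (asboolT q'q).
exact.
Qed.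

(** A minimal sublinear functional is linear: [phi <= tilt phi w], taken at [t = 1], is the missing
    half [phi u + phi w <= phi (u + w)] of additivity. Minimizing below [tilt p v] instead of [p]
    forces [phi (- v) <= - p v], hence [phi v = p v]. *)
Theorem hahn_banach p v : sublinear p -> D v -> exists phi : V -> R,
  [/\ forall u w, D u -> D w -> phi (u + w) = phi u + phi w,
      forall t u, D u -> phi (t *: u) = t * phi u,
      forall u, D u -> phi u <= p u & phi v = p v].
Proof.
move=> pS Dv.
have [phi [phiS phip phimin]] :=
  minimal_sublinear _ (tilt_sublinear _ v pS Dv).
have phi_le u : D u -> phi u <= p u.
  by move=> Du; apply: le_trans (phip _ Du) (tilt_id _ _ _ pS Dv Du).
have DN u : D u -> D (- u) by move=> Du; rewrite -scaleN1r; exact: DZ.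
have phiD u w : D u -> D w -> phi (u + w) = phi u + phi w.
  move=> Du Dw; apply/eqP; rewrite eq_le phiS.1//= -lerBrDr.
  have := phimin _ (tilt_sublinear _ w phiS Dw)
    (fun x => tilt_id _ _ _ phiS Dw) u Du.
  move=> /le_trans; apply.
  by have := tilt_le _ _ _ 1 phiS Dw Du ler01; rewrite scale1r mul1r.
have phiN u : D u -> phi (- u) = - phi u.
  move=> Du; apply/eqP; rewrite -addr_eq0 addrC -phiD ?subrr ?sublinear0//.
  exact: DN.
exists phi; split=> //.
- move=> t u Du; have [t0|t0] := leP 0 t; first exact: sublinearZ.
  rewrite -[t]opprK scaleNr phiN; last exact: DZ.
  by rewrite sublinearZ// ?mulNr// oppr_ge0 ltW.
- apply/eqP; rewrite eq_le phi_le//= -lerN2 -phiN//.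
  apply: le_trans (phip _ (DN _ Dv)) _.
  have := tilt_le _ _ _ 1 pS Dv (DN _ Dv) ler01.
  by rewrite scale1r addNr sublinear0// mul1r sub0r.
Qed.

Lemma dist_sublinear (N : V -> R) (W : set V) : sublinear N ->
  (forall u, D u -> 0 <= N u) -> W `<=` D -> W 0 ->
  (forall u v, W u -> W v -> W (u + v)) ->
  (forall (t : R) u, W u -> W (t *: u)) ->
  sublinear (fun u => inf [set N (u - w) | w in W]).
Proof.
move=> NS N0 WD W0 WA WZ.
have DB u w : D u -> W w -> D (u - w).
  by move=> Du Ww; rewrite -scaleN1r; apply: DD => //; apply: DZ; exact: WD.
have dist_le u w : D u -> W w -> inf [set N (u - w) | w in W] <= N (u - w).
  move=> Du Ww; apply: ge_inf; last by exists w.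
  by exists 0 => _ [w' Ww' <-]; apply: N0; exact: DB.
have le_dist u x : (forall w, W w -> x <= N (u - w)) ->
    x <= inf [set N (u - w) | w in W].
  move=> H; apply: lb_le_inf; first by exists (N (u - 0)), 0.
  by move=> _ [w Ww <-]; exact: H.
split=> [u v Du Dv|t u Du t0].
- rewrite -lerBlDl; apply: (le_dist v) => w Ww; rewrite lerBlDl -lerBlDr.
  apply: (le_dist u) => w' Ww'; rewrite lerBlDr.
  apply: le_trans (dist_le _ _ (DD _ _ Du Dv) (WA _ _ Ww' Ww)) _.
  by rewrite opprD addrACA; apply: NS.1; exact: DB.
- rewrite -ler_pdivrMl//; apply: (le_dist u) => w Ww; rewrite ler_pdivrMl//.
  apply: le_trans (dist_le _ _ (DZ _ _ Du) (WZ t _ Ww)) _.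
  by rewrite -scalerBr; apply: NS.2 => //; exact: DB.
Qed.

(** Hahn-Banach for the distance to [W]: it is below [N], is zero on [W], and is at least 1 at [v],
    where [phi] attains it. *)
Lemma separation (N : V -> R) (W : set V) v : sublinear N ->
  (forall u, D u -> 0 <= N u) -> W `<=` D -> W 0 ->
  (forall u v, W u -> W v -> W (u + v)) ->
  (forall (t : R) u, W u -> W (t *: u)) ->
  D v -> (forall w, W w -> 1 <= N (v - w)) -> exists phi : V -> R,
  [/\ forall u w, D u -> D w -> phi (u + w) = phi u + phi w,
      forall t u, D u -> phi (t *: u) = t * phi u,
      forall u, D u -> phi u <= N u, forall w, W w -> phi w = 0 & phi v != 0].
Proof.
move=> NS N0 WD W0 WA WZ Dv Nv.
have dS := dist_sublinear _ _ NS N0 WD W0 WA WZ.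
have [phi [phiD phiZ phi_le phiv]] := hahn_banach _ v dS Dv.
have phiN u w : D u -> W w -> phi u <= N (u - w).
  move=> Du Ww; apply: le_trans (phi_le _ Du) _.
  apply: ge_inf; last by exists w.
  exists 0 => _ [w' Ww' <-]; apply: N0.
  by rewrite -scaleN1r; apply: DD => //; apply: DZ; exact: WD.
have phiW w : W w -> phi w <= 0.
  by move=> Ww; have := phiN _ _ (WD _ Ww) Ww; rewrite subrr sublinear0.
exists phi; split=> //.
- by move=> u Du; have := phiN _ _ Du W0; rewrite subr0.
- move=> w Ww; apply/eqP; rewrite eq_le phiW//=.
  have := phiW _ (WZ (-1) _ Ww); rewrite phiZ; last exact: WD.
  by rewrite mulN1r oppr_le0.
- rewrite phiv gt_eqF//; apply: lt_le_trans ltr01 _.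
  apply: lb_le_inf; first by exists (N (v - 0)), 0.
  by move=> _ [w Ww <-]; exact: Nv.
Qed.

End HahnBanach.

(** * Unordered sums *)

Section UnorderedSums.
Local Open Scope classical_set_scope.
Local Open Scope ring_scope.
Local Open Scope complex_scope.
Context {R : realType}.
Local Notation C := R[i].
Local Notation Re := complex.Re.
Local Notation Im := complex.Im.

Lemma normc_ge0 (z : C) : 0 <= normc z.
Proof. by case: z => a b; exact: sqrtr_ge0. Qed.

Lemma ler_normcD (y z : C) : normc (y + z) <= normc y + normc z.
Proof. by rewrite -lecR rmorphD; exact: ComplexField.lec_normD. Qed.

Lemma normcR (r : R) : normc r%:C = `|r|.
Proof. by rewrite /= expr0n addr0 sqrtr_sqr. Qed.

Lemma normc_Re (z : C) : `|Re z| <= normc z.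
Proof.
by case: z => a b /=; rewrite -sqrtr_sqr ler_wsqrtr// lerDl sqr_ge0.
Qed.

Lemma normc_Im (z : C) : `|Im z| <= normc z.
Proof.
by case: z => a b /=; rewrite -sqrtr_sqr ler_wsqrtr// lerDr sqr_ge0.
Qed.

Definition asum {I : choiceType} (u : I -> C) : Prop :=
  (\esum_(i in [set: I]) (normc (u i))%:E < +oo)%E.

Definition hsum {I : choiceType} (u : I -> C) (s : C) : Prop :=
  forall e : R, 0 < e -> exists A : {fset I}, forall B : {fset I},
    (A `<=` B)%fset -> normc (\sum_(i <- B) u i - s) < e.

Lemma csum_hsum {I : choiceType} {u : I -> C} {s : C} :
  hsum u s -> csum u = s.
Proof.
move=> us; rewrite /csum /summability.sum.
have totF := @summability.totally_filter I.
apply: (@cvg_lim R[i]^o); first exact: norm_hausdorff.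
apply/(@cvgrPdist_lt _ R[i]^o) => e e0.
(* In the partial order of [R[i]], a positive element is real. *)
have -> : e = (Re e)%:C by case: e e0 => a b; rewrite ltcE /= => /andP[/eqP->].
have /us[A AB] : 0 < Re e by move: e0; rewrite ltcE => /andP[_].
exists A => // B /AB.
rewrite /summability.partial_sum big_seq_fsetE/= -distrC => H.
by rewrite [ltLHS]/Num.Def.normr/= ltcR.
Qed.

Lemma hsumD {I : choiceType} {u v : I -> C} {s t : C} :
  hsum u s -> hsum v t -> hsum (fun i => u i + v i) (s + t).
Proof.
move=> us vt e e0; have e20 : 0 < e / 2 by rewrite divr_gt0.
have [A AB] := us _ e20; have [A' AB'] := vt _ e20.
exists (A `|` A')%fset => B; rewrite fsubUset => /andP[/AB uB /AB' vB].
rewrite big_split/= opprD addrACA (le_lt_trans (ler_normcD _ _))//.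
by rewrite [ltRHS]splitr ltrD.
Qed.

Lemma hsumZ {I : choiceType} (c : C) {u : I -> C} {s : C} :
  hsum u s -> hsum (fun i => c * u i) (c * s).
Proof.
move=> us e e0; have c0 : 0 < normc c + 1 by rewrite ltr_wpDl// normc_ge0.
have [A AB] := us _ (divr_gt0 e0 c0); exists A => B /AB.
rewrite ltr_pdivlMr// => uB; rewrite -mulr_sumr -mulrBr normcM.
rewrite (le_lt_trans _ uB)// mulrC ler_wpM2l ?normc_ge0//.
by rewrite lerDl.
Qed.

Lemma ge0_esum_fset {I : choiceType} (a : I -> R) (B : {fset I}) :
  ((\sum_(i <- B) a i)%:E <= \esum_(i in [set: I]) (a i)%:E)%E.
Proof.
apply: esum_ge; exists [set` B]; first by split.
by rewrite fsbig_finite//= set_fsetK sumEFin.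
Qed.

Lemma esum_fine {I : choiceType} (a : I -> R) : (forall i, 0 <= a i) ->
  (\esum_(i in [set: I]) (a i)%:E < +oo)%E ->
  (fine (\esum_(i in [set: I]) (a i)%:E))%:E = \esum_(i in [set: I]) (a i)%:E.
Proof.
move=> a0 aoo; rewrite fineK// ge0_fin_numE// esum_ge0// => i _.
by rewrite lee_fin.
Qed.

Lemma hsum_ge0 {I : choiceType} (a : I -> R) : (forall i, 0 <= a i) ->
  (\esum_(i in [set: I]) (a i)%:E < +oo)%E ->
  hsum (fun i => (a i)%:C) (fine (\esum_(i in [set: I]) (a i)%:E))%:C.
Proof.
move=> a0 aoo e e0; set S := fine _.
have SE : S%:E = \esum_(i in [set: I]) (a i)%:E by exact: esum_fine.
have : ((S - e)%:E < \esum_(i in [set: I]) (a i)%:E)%E.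
  by rewrite -SE lte_fin ltrBlDr ltrDl.
move=> /ereal_sup_gt[_ [X [finX _] <-]].
rewrite fsbig_finite// sumEFin lte_fin => XS.
exists (fset_set X) => B XB.
rewrite -rmorph_sum -rmorphB normcR ltr_norml.
have BS : \sum_(i <- B) a i <= S by rewrite -lee_fin SE; exact: ge0_esum_fset.
have XB' : \sum_(i <- fset_set X) a i <= \sum_(i <- B) a i.
  rewrite [leRHS](big_fsetID _ (mem (fset_set X)))/=.
  rewrite (_ : [fset x | x in B & x \in fset_set X]%fset = fset_set X).
    by rewrite lerDl sumr_ge0.
  apply/fsetP => x; rewrite !inE/= andbC.
  by case: (boolP (x \in fset_set X)) => //= /(fsubsetP XB).
by apply/andP; split; lra.
Qed.

Lemma le_asum {I : choiceType} (u v : I -> C) :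
  (forall i, normc (u i) <= normc (v i)) -> asum v -> asum u.
Proof.
by move=> uv; apply: le_lt_trans; apply: le_esum => i _; rewrite lee_fin.
Qed.

Lemma ge0_esumD {I : choiceType} (a b : I -> R) :
  (forall i, 0 <= a i) -> (forall i, 0 <= b i) ->
  \esum_(i in [set: I]) (a i + b i)%:E =
  (\esum_(i in [set: I]) (a i)%:E + \esum_(i in [set: I]) (b i)%:E)%E.
Proof.
move=> a0 b0; rewrite -esumD; [|by move=> i _; rewrite lee_fin..].
by apply: eq_esum => i _; rewrite EFinD.
Qed.

Lemma ge0_esumZ {I : choiceType} (r : R) (a : I -> \bar R) :
  (0 <= r) -> (forall i, 0 <= a i)%E ->
  \esum_(i in [set: I]) (r%:E * a i)%E = (r%:E * \esum_(i in [set: I]) a i)%E.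
Proof.
rewrite le_eqVlt => /predU1P[<- _|].
  by rewrite mul0e esum1// => i _; rewrite mul0e.
move: r a; have le (r : R) (a : I -> \bar R) : 0 < r -> (forall i, 0 <= a i)%E ->
    (\esum_(i in [set: I]) (r%:E * a i) <= r%:E * \esum_(i in [set: I]) a i)%E.
  move=> r0 a0; apply: ge_ereal_sup => _ [X [finX _] <-].
  rewrite fsbig_finite// -ge0_sume_distrr//.
  rewrite lee_pmul2l// ?lte_fin//; apply: esum_ge; exists X => //.
  by rewrite fsbig_finite.
move=> r a r0 a0; apply/eqP; rewrite eq_le le//=.
(* The converse inequality is [le] for the factor [r^-1] and the family [r * a]. *)
rewrite -lee_pdivlMl//.
under [leLHS]eq_esum => i _.
  rewrite -[a i](_ : r^-1%:E * (r%:E * a i) = _)%E; last first.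
    by rewrite muleA -EFinM mulVf ?gt_eqF// mul1e.
  over.
by apply: le; rewrite ?invr_gt0// => i; rewrite mule_ge0// lee_fin ltW.
Qed.

Lemma asumD {I : choiceType} {u v : I -> C} :
  asum u -> asum v -> asum (fun i => u i + v i).
Proof.
move=> us vs; rewrite /asum.
apply: (@le_lt_trans _ _
    (\esum_(i in [set: I]) (normc (u i) + normc (v i))%:E)%E).
  by apply: le_esum => i _; rewrite lee_fin ler_normcD.
by rewrite ge0_esumD ?lte_add_pinfty// => i; exact: normc_ge0.
Qed.

Lemma asumZ {I : choiceType} (c : C) {u : I -> C} :
  asum u -> asum (fun i => c * u i).
Proof.
move=> us; rewrite /asum.
under eq_esum => i _ do rewrite normcM EFinM.
rewrite ge0_esumZ ?normc_ge0//; last by move=> i; rewrite lee_fin normc_ge0.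
by rewrite lte_mul_pinfty ?lee_fin ?normc_ge0.
Qed.

(* Every summable family is a complex combination of four nonnegative ones,
   for which [csum] is [esum]. *)
Lemma asum_ind {I : choiceType} (P : (I -> C) -> Prop) :
  (forall a : I -> R, (forall i, 0 <= a i) -> asum (fun i => (a i)%:C) ->
    P (fun i => (a i)%:C)) ->
  (forall u v, asum u -> asum v -> P u -> P v -> P (fun i => u i + v i)) ->
  (forall c u, asum u -> P u -> P (fun i => c * u i)) ->
  forall u, asum u -> P u.
Proof.
move=> Pr PD PZ.
have PR (a : I -> R) : asum (fun i => (a i)%:C) -> P (fun i => (a i)%:C).
  move=> sa; pose p i := Num.max (a i) 0; pose n i := Num.max (- a i) 0.
  have sp : asum (fun i => (p i)%:C).
    apply: le_asum sa => i; rewrite !normcR /p.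
    by rewrite maxEle; case: ifP; rewrite ?normr0.
  have sn : asum (fun i => (n i)%:C).
    apply: le_asum sa => i; rewrite !normcR /n.
    by rewrite maxEle; case: ifP; rewrite ?normr0 ?normrN.
  rewrite (_ : (fun i => _) = fun i => (p i)%:C + (-1) * (n i)%:C).
    apply: (PD _ _ sp (asumZ (-1) sn)).
    - by apply: Pr sp => i; rewrite /p le_max lexx orbT.
    - by apply: (PZ _ _ sn); apply: Pr sn => i; rewrite /n le_max lexx orbT.
  apply/funext => i; rewrite mulN1r -rmorphB/=; congr (_%:C).
  rewrite /p /n !maxEle oppr_le0; case: (lerP (a i) 0) => a0.
    by have [a1|a1] := lerP 0 (a i); lra.
  by rewrite ltW//; lra.
move=> u us.
have sRe : asum (fun i => (Re (u i))%:C).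
  by apply: le_asum us => i; rewrite normcR normc_Re.
have sIm : asum (fun i => (Im (u i))%:C).
  by apply: le_asum us => i; rewrite normcR normc_Im.
rewrite (_ : u = fun i => (Re (u i))%:C + 'i%C * (Im (u i))%:C); last first.
  by apply/funext => i; rewrite -complexE.
by apply: PD; [|exact: asumZ|exact: PR|apply: PZ => //; exact: PR].
Qed.

Lemma hsum_csum {I : choiceType} {u : I -> C} : asum u -> hsum u (csum u).
Proof.
move=> us; suff [s h] : exists s, hsum u s by rewrite (csum_hsum h).
move: u us; apply: asum_ind => [a a0 sa|u v _ _ [s us] [t vt]|c u _ [s us]].
- eexists; apply: hsum_ge0 => //.
  apply: le_lt_trans sa; apply: le_esum => i _.
  by rewrite normcR lee_fin ler_norm.
- by eexists; exact: hsumD us vt.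
- by eexists; exact: hsumZ us.
Qed.

Lemma csumD {I : choiceType} {u v : I -> C} : asum u -> asum v ->
  csum (fun i => u i + v i) = csum u + csum v.
Proof. by move=> us vs; apply/csum_hsum/hsumD; exact: hsum_csum. Qed.

Lemma csumZ {I : choiceType} (c : C) {u : I -> C} : asum u ->
  csum (fun i => c * u i) = c * csum u.
Proof. by move=> us; apply/csum_hsum/hsumZ; exact: hsum_csum. Qed.

Lemma csum_ge0 {I : choiceType} (a : I -> R) : (forall i, 0 <= a i) ->
  asum (fun i => (a i)%:C) ->
  csum (fun i => (a i)%:C) = (fine (\esum_(i in [set: I]) (a i)%:E))%:C.
Proof.
move=> a0 sa; apply/csum_hsum/hsum_ge0 => //.
apply: le_lt_trans sa; apply: le_esum => i _.
by rewrite normcR lee_fin ler_norm.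
Qed.

Lemma asum_esum {I : choiceType} (a : I -> R) : (forall i, 0 <= a i) ->
  asum (fun i => (a i)%:C) -> (\esum_(i in [set: I]) (a i)%:E < +oo)%E.
Proof.
move=> a0; apply: le_lt_trans; apply: le_esum => i _.
by rewrite normcR lee_fin ler_norm.
Qed.

(** Without absolute summability the right side is [+oo], so the unspecified value of [csum] is
    harmless. *)
Lemma normc_csum {I : choiceType} (u : I -> C) :
  ((normc (csum u))%:E <= \esum_(i in [set: I]) (normc (u i))%:E)%E.
Proof.
have [us|] := pselect (asum u); last first.
  rewrite /asum ltNge leye_eq => /negP; rewrite negbK => /eqP ->.
  exact: leey.
apply/lee_addgt0Pr => e e0; have [A AB] := hsum_csum us _ e0.
have := AB A (fsubset_refl _).
rewrite -normcN opprB => /ltW AS.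
apply: (@le_trans _ _ (\sum_(i <- A) normc (u i) + e)%:E); last first.
  by rewrite EFinD leeD2r// ge0_esum_fset.
rewrite lee_fin -[csum u](subrK (\sum_(i <- A) u i)) addrC.
rewrite (le_trans (ler_normcD _ _))// lerD//.
elim/big_ind2: _ => [|x y z t xy zt|//]; first by rewrite normc0.
by rewrite (le_trans (ler_normcD _ _))// lerD.
Qed.

Lemma ge0_esum_ge1 {I : choiceType} (a : I -> \bar R) (i : I) :
  (forall i, 0 <= a i)%E -> (a i <= \esum_(i in [set: I]) a i)%E.
Proof.
move=> a0; apply: esum_ge; exists [set i]; first by split.
by rewrite fsbig_set1.
Qed.

(** * Reindexing and interchange of sums *)

Lemma esum_reindex {I J : choiceType} (e : J -> I) (e' : I -> J)
    (a : I -> \bar R) : cancel e e' -> cancel e' e ->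
  \esum_(j in [set: J]) a (e j) = \esum_(i in [set: I]) a i.
Proof.
move=> ee' e'e; rewrite [RHS](reindex_esum [set: J] _ e)//; split=> //.
  by move=> x y _ _; exact: (can_inj ee').
by move=> i _; exists (e' i).
Qed.

Lemma esum_pair {I J : choiceType} (a : I -> J -> \bar R) :
  (forall i j, 0 <= a i j)%E ->
  \esum_(i in [set: I]) \esum_(j in [set: J]) a i j =
  \esum_(p in [set: I * J]) a p.1 p.2.
Proof.
move=> a0; rewrite esum_esum//; congr esum.
by apply/seteqP; split.
Qed.

Lemma esum_swap {I J : choiceType} (a : I -> J -> \bar R) :
  (forall i j, 0 <= a i j)%E ->
  \esum_(i in [set: I]) \esum_(j in [set: J]) a i j =
  \esum_(j in [set: J]) \esum_(i in [set: I]) a i j.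
Proof.
move=> a0; rewrite !esum_pair//
  -(@esum_reindex (I * J)%type (J * I)%type swap_pair swap_pair)//.
- by case.
- by case.
Qed.

Lemma asum_reindex {I J : choiceType} (e : J -> I) (e' : I -> J)
    (u : I -> C) : cancel e e' -> cancel e' e ->
  asum u -> asum (fun j => u (e j)).
Proof.
by move=> ee' e'e; rewrite /asum (esum_reindex e e' (fun i => (normc (u i))%:E)).
Qed.

Lemma csum_reindex {I J : choiceType} (e : J -> I) (e' : I -> J)
    (u : I -> C) : cancel e e' -> cancel e' e ->
  asum u -> csum (fun j => u (e j)) = csum u.
Proof.
move=> ee' e'e; move: u.
apply: asum_ind => [a a0 sa|u v su sv IHu IHv|c u su IHu].
- rewrite !csum_ge0//; last exact: (asum_reindex e e' (fun i => (a i)%:C)).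
  by congr (fine _)%:C; exact: (esum_reindex e e' (fun i => (a i)%:E)).
- by rewrite (csumD su sv) -IHu -IHv -csumD//; exact: (asum_reindex e e').
- by rewrite (csumZ c su) -IHu -csumZ//; exact: (asum_reindex e e').
Qed.

Lemma asum_row {I J : choiceType} {w : I * J -> C} (i : I) :
  asum w -> asum (fun j => w (i, j)).
Proof.
apply: le_lt_trans.
rewrite (_ : (fun p => _) = (fun p => (normc (w (p.1, p.2)))%:E)); last first.
  by apply/funext => -[].
have w0 i' j : (0 <= (normc (w (i', j)))%:E)%E by rewrite lee_fin normc_ge0.
rewrite -(esum_pair (fun i j => (normc (w (i, j)))%:E))//.
apply: (ge0_esum_ge1 (fun i => \esum_(j in [set: J]) (normc (w (i, j)))%:E)%E).
by move=> i'; apply: esum_ge0.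
Qed.

Lemma asum_csum {I J : choiceType} {w : I * J -> C} :
  asum w -> asum (fun i => csum (fun j => w (i, j))).
Proof.
apply: le_lt_trans.
rewrite (_ : (fun p => (normc (w p))%:E) =
             (fun p => (normc (w (p.1, p.2)))%:E)); last first.
  by apply/funext => -[].
rewrite -(esum_pair (fun i j => (normc (w (i, j)))%:E)); last first.
  by move=> i j; rewrite lee_fin normc_ge0.
by apply: le_esum => i _; exact: normc_csum.
Qed.

Lemma asum_swap {I J : choiceType} {w : I * J -> C} :
  asum w -> asum (fun p : J * I => w (swap_pair p)).
Proof. by apply: (asum_reindex swap_pair swap_pair) => -[]. Qed.

Lemma csum_swap_pair {I J : choiceType} (w : I * J -> C) : asum w ->
  csum (fun i => csum (fun j => w (i, j))) =
  csum (fun j => csum (fun i => w (i, j))).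
Proof.
move: w; apply: asum_ind => [a a0 sa|u v su sv IHu IHv|c u su IHu].
- have aoo := asum_esum _ a0 sa.
  (* Stated for arbitrary index types so as to serve both orders of summation, the second through
     [swap_pair]. *)
  have sum1 (K L : choiceType) (b : K * L -> R) : (forall p, 0 <= b p) ->
      asum (fun p => (b p)%:C) ->
      csum (fun k => csum (fun l => (b (k, l))%:C)) =
      (fine (\esum_(k in [set: K]) \esum_(l in [set: L]) (b (k, l))%:E))%:C.
    move=> b0 sb.
    have row k := asum_row k sb.
    under eq_fun => k do rewrite csum_ge0//.
    rewrite csum_ge0.
    + congr (fine _)%:C; apply: eq_esum => k _.
      by rewrite esum_fine//; apply: asum_esum.
    + by move=> k; rewrite fine_ge0// esum_ge0// => l _; rewrite lee_fin.
    + rewrite (_ : (fun k => _) = fun k => csum (fun l => (b (k, l))%:C)).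
        exact: (asum_csum sb).
      by apply/funext => k; rewrite csum_ge0.
  rewrite (sum1 _ _ a)// (sum1 _ _ (fun p => a (swap_pair p)))//; last first.
    exact: (asum_swap sa).
  congr (fine _)%:C; apply: esum_swap => i j; rewrite lee_fin; exact: a0.
- have rD (K L : choiceType) (x y : K * L -> C) : asum x -> asum y ->
      csum (fun i => csum (fun j => x (i, j) + y (i, j))) =
      csum (fun i => csum (fun j => x (i, j))) +
      csum (fun i => csum (fun j => y (i, j))).
    move=> sx sy; rewrite -csumD; [|exact: asum_csum..].
    by congr csum; apply/funext => i; rewrite csumD//; exact: asum_row.
  by rewrite rD// IHu IHv (rD _ _ _ _ (asum_swap su) (asum_swap sv)).
- have rZ (K L : choiceType) (x : K * L -> C) : asum x ->
      csum (fun i => csum (fun j => c * x (i, j))) =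
      c * csum (fun i => csum (fun j => x (i, j))).
    move=> sx; rewrite -csumZ; last exact: asum_csum.
    by congr csum; apply/funext => i; rewrite csumZ//; exact: asum_row.
  by rewrite rZ// IHu (rZ _ _ _ (asum_swap su)).
Qed.

Lemma csum_swap {I J : choiceType} (u : I -> J -> C) :
  (\esum_(i in [set: I]) \esum_(j in [set: J]) (normc (u i j))%:E < +oo)%E ->
  csum (fun i => csum (u i)) = csum (fun j => csum (u ^~ j)).
Proof.
rewrite esum_pair; last by move=> i j; rewrite lee_fin normc_ge0.
exact: (csum_swap_pair (fun p => u p.1 p.2)).
Qed.

Lemma hsum_supp1 {I : choiceType} (u : I -> C) (k : I) :
  (forall i, i != k -> u i = 0) -> hsum u (u k).
Proof.
move=> u0 e e0; exists [fset k]%fset => B; rewrite fsub1set => kB.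
rewrite (big_fsetD1 k)//= big1_fset ?addr0 ?subrr.
  by rewrite normc0.
by move=> i; rewrite !inE => /andP[/u0].
Qed.

Lemma csum_supp1 {I : choiceType} (u : I -> C) (k : I) :
  (forall i, i != k -> u i = 0) -> csum u = u k.
Proof. by move=> u0; apply/csum_hsum/hsum_supp1. Qed.

Lemma csum0 {I : choiceType} : csum (fun _ : I => 0 : C) = 0.
Proof.
apply: csum_hsum => e e0; exists fset0 => B _.
by rewrite big1// subrr normc0.
Qed.

(** Summability is assumed of the products only. If [c] is 0 then [u] may fail to be summable, but
    both sides are 0; otherwise divide by [c]. *)
Lemma csumZr {I : choiceType} (c : C) (u : I -> C) : asum (fun i => u i * c) ->
  csum (fun i => u i * c) = csum u * c.
Proof.
have [->|c0] := eqVneq c 0.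
  move=> _; rewrite mulr0 -[RHS](@csum0 I); congr csum.
  by apply/funext => i; rewrite mulr0.
move=> suc; have su : asum u.
  rewrite (_ : u = fun i => c^-1 * (u i * c)); first exact: asumZ.
  by apply/funext => i; rewrite mulrC mulfK.
rewrite mulrC -csumZ//; congr csum; by apply/funext => i; rewrite mulrC.
Qed.

Lemma csumZl {I : choiceType} (c : C) (u : I -> C) : asum (fun i => c * u i) ->
  csum (fun i => c * u i) = c * csum u.
Proof.
rewrite (_ : (fun i => c * u i) = fun i => u i * c); last first.
  by apply/funext => i; rewrite mulrC.
by move=> /csumZr ->; rewrite mulrC.
Qed.

Lemma ge0_esum_recl (a : nat -> \bar R) : (forall n, 0 <= a n)%E ->
  \esum_(n in [set: nat]) a n = (a 0%N + \esum_(n in [set: nat]) a n.+1)%E.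
Proof.
move=> a0; rewrite (esumID [set 0%N])//; congr (_ + _)%E.
  by rewrite setTI esum_set1.
rewrite (reindex_esum [set: nat] _ S)//; split.
- by move=> n _; split.
- by move=> m n _ _ [].
- by move=> [|n] [_ n0]; [case: n0|exists n].
Qed.

Lemma asum_shift (u : nat -> C) : asum u -> asum (fun n => u n.+1).
Proof.
apply: le_lt_trans; rewrite [leRHS]ge0_esum_recl; last first.
  by move=> n; rewrite lee_fin normc_ge0.
by rewrite leeDr// lee_fin normc_ge0.
Qed.

Lemma csum_recl (u : nat -> C) : asum u ->
  csum u = u 0%N + csum (fun n => u n.+1).
Proof.
move: u; apply: asum_ind => [a a0 sa|u v su sv IHu IHv|c u su IHu].
- rewrite !csum_ge0//; last exact: (asum_shift _ sa).
  rewrite -rmorphD; congr (_%:C).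
  rewrite ge0_esum_recl ?fineD//.
  rewrite ge0_fin_numE; last by apply: esum_ge0 => n _; rewrite lee_fin.
  exact: (asum_esum (fun n => a n.+1) (fun n => a0 n.+1) (asum_shift _ sa)).
- rewrite (csumD su sv) (csumD (asum_shift _ su) (asum_shift _ sv)) IHu IHv.
  by rewrite addrACA.
- by rewrite (csumZ c su) (csumZ c (asum_shift _ su)) IHu mulrDr.
Qed.

End UnorderedSums.

(** * Convolution and [rho] *)

Section WeightedConvolution.
Local Open Scope classical_set_scope.
Local Open Scope ring_scope.
Local Open Scope complex_scope.
Context {R : realType} {G : groupType}.
Local Notation C := R[i].
Implicit Types (omega theta sigma : G -> R) (a b c f g h : G -> C).

Definition l1norm omega a : \bar R :=
  \esum_(x in [set: G]) (normc (a x) * omega x)%:E.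

Lemma l1norm_ge0 omega a : (forall x, 0 <= omega x) -> (0 <= l1norm omega a)%E.
Proof.
by move=> o0; apply: esum_ge0 => x _; rewrite lee_fin mulr_ge0 ?normc_ge0.
Qed.

Lemma fine_l1norm omega a : (forall x, 0 <= omega x) -> l1 omega a ->
  (fine (l1norm omega a))%:E = l1norm omega a.
Proof. by move=> o0 ao; rewrite fineK// ge0_fin_numE// l1norm_ge0. Qed.

Lemma l1_le_fine omega a x : (forall x, 0 <= omega x) -> l1 omega a ->
  normc (a x) * omega x <= fine (l1norm omega a).
Proof.
move=> o0 ao; rewrite -lee_fin fine_l1norm//.
apply: (ge0_esum_ge1 (fun x => (normc (a x) * omega x)%:E)) => y.
by rewrite lee_fin mulr_ge0 ?normc_ge0.
Qed.

(* The growth condition under which [conv a b] makes sense when [normc \o a] is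
   bounded by [theta] and [b] is in [l1 sigma]; it covers both [a] in
   [l1 omega] and the unbounded functions [omega * g] for [g] in [linfty]. *)
Definition moderate theta sigma : Prop :=
  [/\ forall x, 0 <= theta x, forall x, 0 <= sigma x &
      forall x y, theta (x * y^-1)%g <= theta x * sigma y].

Lemma esum_conv_le theta sigma a b z : moderate theta sigma ->
  (forall x, normc (a x) <= theta x) ->
  (\esum_(y in [set: G]) (normc (a (z * y^-1)%g * b y))%:E <=
   (theta z)%:E * l1norm sigma b)%E.
Proof.
move=> [t0 s0 ts] at_; rewrite -ge0_esumZ//; last first.
  by move=> y; rewrite lee_fin mulr_ge0 ?normc_ge0.
apply: le_esum => y _; rewrite -EFinM lee_fin normcM.
rewrite mulrCA [leLHS]mulrC ler_wpM2l ?normc_ge0//.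
exact: le_trans (at_ _) (ts _ _).
Qed.

Lemma asum_conv theta sigma a b z : moderate theta sigma ->
  (forall x, normc (a x) <= theta x) -> l1 sigma b ->
  asum (fun y => a (z * y^-1)%g * b y).
Proof.
move=> ts at_ sb; apply: le_lt_trans (esum_conv_le _ _ _ _ z ts at_) _.
by rewrite lte_mul_pinfty// lee_fin; case: ts.
Qed.

(** Fubini, with two applications of the growth condition, [theta (z * w^-1 * y^-1) <= theta z *
    sigma w * sigma y]; the double sum is at most [theta z] times the norms of [b] and [c]. *)
Lemma conv_assoc theta sigma a b c : moderate theta sigma ->
  (forall x, normc (a x) <= theta x) -> l1 sigma b -> l1 sigma c ->
  conv (conv a b) c = conv a (conv b c).
Proof.
move=> [t0 s0 ts] at_ sb sc; apply/funext => z.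
(* Summing over [w] first gives [conv a (conv b c)]; the substitution [v = y * w] in each row gives
   [conv (conv a b) c]. *)
pose u w v := a (z * v^-1)%g * (b (v * w^-1)%g * c w).
have uE w y : u w (y * w)%g = a (z * w^-1 * y^-1)%g * b y * c w.
  by rewrite /u invgM !mulgA mulgK mulrA.
have sumu : (\esum_(w in [set: G]) \esum_(v in [set: G])
    (normc (u w v))%:E < +oo)%E.
  apply: (@le_lt_trans _ _
      ((theta z * fine (l1norm sigma b))%:E * l1norm sigma c)%E); last first.
    by rewrite lte_mul_pinfty// lee_fin mulr_ge0// fine_ge0// l1norm_ge0.
  rewrite -ge0_esumZ; last 2 first.
    - by rewrite mulr_ge0// fine_ge0// l1norm_ge0.
    - by move=> y; rewrite lee_fin mulr_ge0 ?normc_ge0.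
  apply: le_esum => w _.
  rewrite -(esum_reindex (fun y => y * w)%g (fun v => v * w^-1)%g).
  + rewrite EFinM fine_l1norm// -muleA (muleC (l1norm _ _)) muleA -EFinM.
    rewrite -ge0_esumZ; last 2 first.
      - by rewrite !mulr_ge0 ?normc_ge0.
      - by move=> y; rewrite lee_fin mulr_ge0 ?normc_ge0.
    apply: le_esum => y _; rewrite -EFinM lee_fin uE !normcM.
    rewrite (_ : _ * _ * (_ * _) =
      (theta z * sigma w * sigma y) * normc (b y) * normc (c w)); last by ring.
    rewrite ler_wpM2r ?normc_ge0// ler_wpM2r ?normc_ge0//.
    apply: (le_trans (at_ _)); apply: (le_trans (ts _ _)).
    by rewrite ler_wpM2r.
  + exact: mulgK.
  + exact: mulgVK.
have asumu : asum (fun p : G * G => u p.1 p.2).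
  rewrite /asum -(esum_pair (fun w v => (normc (u w v))%:E))// => w v.
  by rewrite lee_fin normc_ge0.
have rowu w : asum (u w) by exact: (asum_row w asumu).
have rowu' w : asum (fun y => u w (y * w)%g).
  apply: (asum_reindex (fun y => y * w)%g (fun v => v * w^-1)%g) => //.
  - exact: mulgK.
  - exact: mulgVK.
transitivity (csum (fun w => csum (u w))).
  congr csum; apply/funext => w.
  rewrite -(csum_reindex (fun y => y * w)%g (fun v => v * w^-1)%g)//.
  + rewrite -csumZr; first by congr csum; apply/funext => y; rewrite uE.
    by have := rowu' w; congr asum; apply/funext => y; rewrite uE.
  + exact: mulgK.
  + exact: mulgVK.
rewrite csum_swap//; congr csum; apply/funext => v.
by rewrite /u csumZl//; exact: (asum_row v (asum_swap asumu)).
Qed.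

Lemma conv_delta1r a : conv a delta1 = a.
Proof.
apply/funext => z; rewrite /conv (csum_supp1 _ 1%g).
  by rewrite invg1 mulg1 /delta1 eqxx mulr1.
by move=> y /negPf y1; rewrite /delta1 y1 mulr0.
Qed.

Definition point_mass (x : G) (k : C) : G -> C :=
  fun y => if y == x then k else 0.

Lemma l1norm_point_mass omega x k : (forall x, 0 <= omega x) ->
  l1norm omega (point_mass x k) = (normc k * omega x)%:E.
Proof.
move=> o0; have kx0 : (0 <= (normc k * omega x)%:E)%E.
  by rewrite lee_fin mulr_ge0 ?normc_ge0.
rewrite -(@esum_set1 R G x (fun x => (normc k * omega x)%:E))//.
rewrite esum_mkcond; apply: eq_esum => y _.
rewrite /point_mass (_ : (y \in [set x]) = (y == x)); last first.
  by apply/idP/eqP => [/set_mem|->]; [|exact: mem_set].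
by case: eqP => _; rewrite ?normc0 ?mul0r.
Qed.

Lemma delta1E : delta1 = point_mass 1%g 1.
Proof. by apply/funext => x; rewrite /point_mass /delta1; case: eqP. Qed.

Lemma l1norm_delta1 omega : (forall x, 0 <= omega x) ->
  l1norm omega delta1 = (omega 1%g)%:E.
Proof.
by move=> o0; rewrite delta1E l1norm_point_mass// normc1 mul1r.
Qed.

Lemma l1norm0 omega : l1norm omega (fun _ => 0) = 0%E.
Proof. by apply: esum1 => x _; rewrite normc0 mul0r. Qed.

Lemma l1normZ omega (k : C) a : (forall x, 0 <= omega x) ->
  l1norm omega (fun x => k * a x) = ((normc k)%:E * l1norm omega a)%E.
Proof.
move=> o0; rewrite -ge0_esumZ ?normc_ge0//.
  by apply: eq_esum => x _; rewrite normcM -EFinM mulrA.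
by move=> x; rewrite lee_fin mulr_ge0 ?normc_ge0.
Qed.

Lemma l1normD omega a b : (forall x, 0 <= omega x) ->
  (l1norm omega (fun x => (a x + b x)%R) <= l1norm omega a + l1norm omega b)%E.
Proof.
move=> o0; rewrite -ge0_esumD.
  by apply: le_esum => x _; rewrite lee_fin -mulrDl ler_wpM2r ?ler_normcD.
all: by move=> x; rewrite mulr_ge0 ?normc_ge0.
Qed.

(** * The convolution algebra [l1 omega] *)

Lemma l1_moderate omega : weight omega -> forall r, 0 <= r ->
  moderate (fun x => r / omega x) omega.
Proof.
move=> [o0 oM] r r0; split=> [x|x|x y]; rewrite ?divr_ge0 ?(ltW (o0 _))//.
(* This is [omega x <= omega (x * y^-1) * omega y] with two of the factors inverted. *)
rewrite -mulrA ler_wpM2l// mulrC ler_pdivlMr// mulrC ler_pdivrMr// mulrC.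
by rewrite -{1}[x](mulgVK y).
Qed.

Lemma l1_bound omega a : weight omega -> l1 omega a ->
  forall x, normc (a x) <= fine (l1norm omega a) / omega x.
Proof.
move=> [o0 _] ao x; rewrite ler_pdivlMr//; apply: l1_le_fine => // y.
exact: ltW.
Qed.

Lemma asum_conv_l1 omega a b z : weight omega -> l1 omega a -> l1 omega b ->
  asum (fun y => a (z * y^-1)%g * b y).
Proof.
move=> wo ao bo; apply: (asum_conv _ _ _ _ _ _ (l1_bound _ _ wo ao) bo).
apply: l1_moderate => //; rewrite fine_ge0// l1norm_ge0// => x.
by rewrite ltW// wo.1.
Qed.

Lemma conv_assoc_l1 omega a b c : weight omega ->
  l1 omega a -> l1 omega b -> l1 omega c ->
  conv (conv a b) c = conv a (conv b c).
Proof.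
move=> wo ao bo co; apply: (conv_assoc _ _ _ _ _ _ (l1_bound _ _ wo ao) bo co).
apply: l1_moderate => //; rewrite fine_ge0// l1norm_ge0// => x.
by rewrite ltW// wo.1.
Qed.

Lemma l1norm_conv omega a b : weight omega -> l1 omega a ->
  (l1norm omega (conv a b) <= l1norm omega a * l1norm omega b)%E.
Proof.
move=> [o0 oM] ao; have o0' x : 0 <= omega x by rewrite ltW.
pose A x := normc (a x) * omega x; pose B x := normc (b x) * omega x.
have A0 x : 0 <= A x by rewrite mulr_ge0 ?normc_ge0.
have B0 x : 0 <= B x by rewrite mulr_ge0 ?normc_ge0.
apply: (@le_trans _ _ (\esum_(z in [set: G]) \esum_(y in [set: G])
    (A (z * y^-1)%g * B y)%:E)%E).
  apply: le_esum => z _; rewrite mulrC EFinM.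
  apply: (@le_trans _ _ ((omega z)%:E *
      \esum_(y in [set: G]) (normc (a (z * y^-1)%g * b y))%:E)%E).
    by rewrite lee_wpmul2l ?lee_fin//; exact: normc_csum.
  rewrite -ge0_esumZ//; last by move=> y; rewrite lee_fin normc_ge0.
  apply: le_esum => y _; rewrite -EFinM lee_fin normcM.
  rewrite /A /B mulrACA mulrC ler_wpM2l ?mulr_ge0 ?normc_ge0//.
  by rewrite -{1}[z](mulgVK y).
rewrite esum_swap; last by move=> z y; rewrite lee_fin mulr_ge0.
rewrite -fine_l1norm// -ge0_esumZ ?fine_ge0 ?l1norm_ge0//.
apply: le_esum => y _.
rewrite (_ : (fun z => _) = fun z => ((B y)%:E * (A (z * y^-1)%g)%:E)%E).
  rewrite ge0_esumZ//; last by move=> z; rewrite lee_fin.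
  rewrite muleC.
  have -> : \esum_(z in [set: G]) (A (z * y^-1)%g)%:E = l1norm omega a.
    apply: (esum_reindex (fun z => z * y^-1)%g (fun z => z * y)%g
      (fun x => (A x)%:E)).
      exact: mulgVK.
    exact: mulgK.
  by rewrite fine_l1norm.
by apply/funext => z; rewrite -EFinM mulrC.
Qed.

Lemma l1_conv omega a b : weight omega -> l1 omega a -> l1 omega b ->
  l1 omega (conv a b).
Proof.
move=> wo ao bo; have o0 x : 0 <= omega x by rewrite ltW// wo.1.
apply: (le_lt_trans (l1norm_conv _ _ _ wo ao)).
by rewrite -fine_l1norm// lte_mul_pinfty// lee_fin fine_ge0// l1norm_ge0.
Qed.

Lemma l1D omega a b : (forall x, 0 <= omega x) -> l1 omega a -> l1 omega b ->
  l1 omega (fun x => a x + b x).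
Proof.
by move=> o0 ao bo; apply: (le_lt_trans (l1normD _ _ _ o0)); exact: lte_add_pinfty.
Qed.

Lemma l1Z omega (k : C) a : (forall x, 0 <= omega x) -> l1 omega a ->
  l1 omega (fun x => k * a x).
Proof.
move=> o0 ao; rewrite /l1 /= -/(l1norm omega (fun x => k * a x)) l1normZ//.
by rewrite lte_mul_pinfty ?lee_fin ?normc_ge0.
Qed.

Lemma l1_delta1 omega : (forall x, 0 <= omega x) -> l1 omega delta1.
Proof.
by move=> o0; rewrite /l1 /= -/(l1norm omega delta1) l1norm_delta1// ltry.
Qed.

Lemma convDl omega a b c : weight omega -> l1 omega a -> l1 omega b ->
  l1 omega c -> conv (fun x => a x + b x) c = fun z => conv a c z + conv b c z.
Proof.
move=> wo ao bo co; apply/funext => z.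
rewrite /conv -csumD; [|exact: (asum_conv_l1 omega)..].
by congr csum; apply/funext => y; rewrite mulrDl.
Qed.

Lemma convDr omega a b c : weight omega -> l1 omega a -> l1 omega b ->
  l1 omega c -> conv a (fun x => b x + c x) = fun z => conv a b z + conv a c z.
Proof.
move=> wo ao bo co; apply/funext => z.
rewrite /conv -csumD; [|exact: (asum_conv_l1 omega)..].
by congr csum; apply/funext => y; rewrite mulrDr.
Qed.

Lemma convZl omega (k : C) a b : weight omega -> l1 omega a -> l1 omega b ->
  conv (fun x => k * a x) b = fun z => k * conv a b z.
Proof.
move=> wo ao bo; apply/funext => z.
rewrite /conv -csumZ; last exact: (asum_conv_l1 omega).
by congr csum; apply/funext => y; rewrite mulrA.
Qed.

Lemma convZr omega (k : C) a b : weight omega -> l1 omega a -> l1 omega b ->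
  conv a (fun x => k * b x) = fun z => k * conv a b z.
Proof.
move=> wo ao bo; apply/funext => z.
rewrite /conv -csumZ; last exact: (asum_conv_l1 omega).
by congr csum; apply/funext => y; rewrite mulrCA.
Qed.

(** * The operator [rho] and its multiplicativity *)

Lemma linfty_moderate omega : weight omega -> forall r, 0 <= r ->
  moderate (fun x => r * omega x) (fun x => omega x^-1%g).
Proof.
move=> [o0 oM] r r0; split=> [x|x|x y]; rewrite ?mulr_ge0 ?(ltW (o0 _))//.
by rewrite -mulrA ler_wpM2l.
Qed.

Lemma linfty_ge0P g : linfty R G g -> exists2 M : R, 0 <= M &
  forall x, normc (g x) <= M.
Proof.
move=> [M gM]; exists M => //.
exact: le_trans (normc_ge0 _) (gM 1%g).
Qed.

Lemma linfty_bound omega g : weight omega -> linfty R G g ->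
  exists2 M : R, 0 <= M & forall x,
    normc ((omega x)%:C * g x) <= M * omega x.
Proof.
move=> [o0 _] /linfty_ge0P[M M0 gM]; exists M => // x.
by rewrite normcM normcR gtr0_norm// mulrC ler_wpM2r// ltW.
Qed.

(** The reflected weight is the [sigma] of [linfty_moderate], so the reflected [f] may be convolved
    with the possibly unbounded function [omega * g]. *)
Lemma l1_flip omega f : l1 omega f ->
  l1 (fun x => omega x^-1%g) (fun x => f x^-1%g).
Proof.
rewrite /l1 /=.
by rewrite (esum_reindex (fun x => x^-1)%g (fun x => x^-1)%g
  (fun x => (normc (f x) * omega x)%:E)) //; exact: invgK.
Qed.

(** Inversion is an antiautomorphism of the group, hence reverses convolution products. *)
Lemma conv_flip omega f h : weight omega -> l1 omega f -> l1 omega h ->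
  conv (fun x => h x^-1%g) (fun x => f x^-1%g) = fun x => conv f h x^-1%g.
Proof.
move=> wo lf lh; apply/funext => z.
rewrite [RHS]/conv -[RHS](csum_reindex (fun y => y * z^-1)%g (fun y => y * z)%g).
- congr csum; apply/funext => y.
  by rewrite !invgM !invgK mulKg mulrC.
- exact: mulgVK.
- exact: mulgK.
- exact: (asum_conv_l1 omega).
Qed.

(* Up to the isometry [g |-> omega * g], [rho omega f] is right convolution by
   the function [x |-> f x^-1]. *)
Lemma rho_conv omega f g x : weight omega -> l1 omega f -> linfty R G g ->
  (omega x)%:C * rho omega f g x =
  conv (fun x => (omega x)%:C * g x) (fun y => f y^-1%g) x.
Proof.
move=> wo lf gb; have [M M0 gM] := linfty_bound _ _ wo gb.
pose u y := (omega (x * y)%g)%:C * g (x * y)%g * f y.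
have su' : asum (fun y => u y^-1%g).
  exact: (asum_conv _ _ _ _ x (linfty_moderate _ wo _ M0) gM (l1_flip _ _ lf)).
have su : asum u.
  have := asum_reindex (fun y => y^-1)%g (fun y => y^-1)%g _
    (@invgK G) (@invgK G) su'.
  by congr asum; apply/funext => y; rewrite invgK.
have uE : u = fun y => (omega x)%:C *
    ((omega (x * y)%g / omega x)%:C * g (x * y)%g * f y).
  apply/funext => y; rewrite /u 2!mulrA -rmorphM mulrCA mulfV ?mulr1//.
  by rewrite gt_eqF// wo.1.
rewrite /rho -csumZl -uE//; symmetry.
exact: (csum_reindex (fun y => y^-1)%g (fun y => y^-1)%g u (@invgK G) (@invgK G)).
Qed.

Lemma rho_linfty omega f g : weight omega -> l1 omega f -> linfty R G g ->
  linfty R G (rho omega f g).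
Proof.
move=> wo lf /linfty_ge0P[M M0 gM].
have o0 x : 0 <= omega x by rewrite ltW ?wo.1.
exists (M * fine (l1norm omega f)) => x.
rewrite -lee_fin EFinM fine_l1norm// -ge0_esumZ//; last first.
  by move=> y; rewrite lee_fin mulr_ge0 ?normc_ge0.
apply: le_trans (normc_csum _) _; apply: le_esum => y _.
rewrite -EFinM lee_fin !normcM normcR ger0_norm ?divr_ge0//.
rewrite [leLHS]mulrC [leRHS]mulrCA ler_wpM2l ?normc_ge0// [leLHS]mulrC.
rewrite ler_pM ?normc_ge0 ?divr_ge0//.
by rewrite ler_pdivrMr ?wo.1// mulrC wo.2.
Qed.

(** Composing right convolutions reverses the factors and so does reflection; the two reversals
    cancel, which makes [rho] multiplicative rather than antimultiplicative. *)
Lemma rho_comp omega f h g : weight omega -> l1 omega f -> l1 omega h ->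
  linfty R G g -> rho omega f (rho omega h g) = rho omega (conv f h) g.
Proof.
move=> wo lf lh gb; apply/funext => x.
have o0 : (omega x)%:C != 0 by rewrite (inj_eq (@complexI R)) gt_eqF ?wo.1.
apply: (mulfI o0).
rewrite rho_conv//; last exact: rho_linfty.
rewrite rho_conv//; last exact: l1_conv.
rewrite -(conv_flip omega)//.
have [M M0 gM] := linfty_bound _ _ wo gb.
rewrite -(conv_assoc _ _ _ _ _ (linfty_moderate _ wo _ M0) gM
  (l1_flip _ _ lh) (l1_flip _ _ lf)).
by congr (conv _ _ x); apply/funext => z; rewrite rho_conv.
Qed.

Lemma rho_delta1 omega g : weight omega -> rho omega delta1 g = g.
Proof.
move=> wo; apply/funext => x; rewrite /rho (csum_supp1 _ 1%g).
  by rewrite mulg1 divff ?gt_eqF ?wo.1// mul1r /delta1 eqxx mulr1.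
by move=> y /negPf y1; rewrite /delta1 y1 mulr0.
Qed.

Lemma l1_invertible_rho_bij omega f : weight omega -> l1 omega f ->
  l1_invertible omega f -> set_bij (linfty R G) (linfty R G) (rho omega f).
Proof.
move=> wo lf [h lh [fh hf]]; split.
- by move=> g /=; exact: rho_linfty.
- move=> g g' /set_mem gb /set_mem gb' /(congr1 (rho omega h)).
  by rewrite !rho_comp// hf !rho_delta1.
- move=> g gb; exists (rho omega h g); first exact: rho_linfty.
  by rewrite rho_comp// fh rho_delta1.
Qed.

(** * The Neumann series *)

Definition conv_pow h n : G -> C := iter n (fun a => conv a h) delta1.

(** The factor [omega 1] is the norm of the zeroth power [delta1]; it may exceed 1. *)
Lemma conv_pow_le omega h q : weight omega -> (l1norm omega h <= q%:E)%E ->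
  forall n, l1 omega (conv_pow h n) /\
  (l1norm omega (conv_pow h n) <= (omega 1%g * q ^+ n)%:E)%E.
Proof.
move=> wo hq; have o0 x : 0 <= omega x by rewrite ltW ?wo.1.
have lh : l1 omega h by exact: le_lt_trans hq (ltry _).
elim=> [|n [ln IHn]].
  by rewrite /= expr0 mulr1 -(l1norm_delta1 _ o0); split=> //; exact: l1_delta1.
split; first exact: l1_conv.
apply: le_trans (l1norm_conv _ _ _ wo ln) _.
by rewrite exprSr mulrA EFinM lee_pmul// l1norm_ge0.
Qed.

(** The powers of [h] are summed pointwise. Their norms are dominated by a geometric series, and
    Tonelli turns this into summability at each point and membership of the sum [u] in [l1 omega].
    Convolving with [h] shifts the series by one, so [u - conv u h] is its first term [delta1]. *)
Lemma neumann omega h : weight omega -> (l1norm omega h < 1)%E ->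
  exists2 u, l1 omega u & conv u (fun x => delta1 x - h x) = delta1.
Proof.
move=> wo h1; have o0 x : 0 <= omega x by rewrite ltW ?wo.1.
have lh : l1 omega h by exact: lt_trans h1 (ltry _).
pose q := fine (l1norm omega h).
have hq : l1norm omega h = q%:E by rewrite fine_l1norm.
have q0 : 0 <= q by rewrite fine_ge0 ?l1norm_ge0.
have q1 : q < 1 by rewrite -lte_fin -hq.
have hq' : (l1norm omega h <= q%:E)%E by rewrite hq.
pose p n := conv_pow h n.
have lp n : l1 omega (p n) := (conv_pow_le _ _ _ wo hq' n).1.
have pq n : (l1norm omega (p n) <= (omega 1%g * q ^+ n)%:E)%E :=
  (conv_pow_le _ _ _ wo hq' n).2.
have sump : (\esum_(n in [set: nat]) l1norm omega (p n) < +oo)%E.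
  apply: (@le_lt_trans _ _ (\esum_(n in [set: nat]) (omega 1%g * q ^+ n)%:E)%E).
    exact: le_esum.
  rewrite -nneseries_esumT; last by move=> n; rewrite lee_fin mulr_ge0 ?exprn_ge0.
  have qn : `|q| < 1 by rewrite ger0_norm.
  have q1' : 0 < 1 - q by rewrite subr_gt0.
  apply: (@le_lt_trans _ _ (omega 1%g / (1 - q))%:E); last exact: ltry.
  apply: lime_le.
    by apply: is_cvg_nneseries => n _ _; rewrite lee_fin mulr_ge0 ?exprn_ge0.
  apply: nearW => n; rewrite sumEFin lee_fin.
  have := congr1 (@^~ n) (geometric_seriesE (omega 1%g) (negbT (lt_eqF q1))).
  rewrite /series/= => ->; rewrite ler_pM2r ?invr_gt0// ler_piMr//.
  by rewrite lerBlDr lerDl exprn_ge0.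
have sumE : \esum_(n in [set: nat]) l1norm omega (p n) =
    \esum_(x in [set: G]) \esum_(n in [set: nat]) (normc (p n x) * omega x)%:E.
  by rewrite esum_swap// => n x; rewrite lee_fin mulr_ge0 ?normc_ge0.
have sumox x : (\esum_(n in [set: nat]) (normc (p n x) * omega x)%:E < +oo)%E.
  apply: le_lt_trans sump; rewrite sumE.
  apply: (ge0_esum_ge1 (fun x =>
    \esum_(n in [set: nat]) (normc (p n x) * omega x)%:E)).
  by move=> y; apply: esum_ge0 => n _; rewrite lee_fin mulr_ge0 ?normc_ge0.
have sumx x : asum (fun n => p n x).
  rewrite (_ : (fun n => _) =
    fun n => ((omega x)^-1)%:C * (p n x * (omega x)%:C)).
    apply: asumZ; rewrite /asum; apply: le_lt_trans (sumox x).
    by apply: le_esum => n _; rewrite lee_fin normcM normcR ger0_norm.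
  apply/funext => n; rewrite mulrCA -rmorphM mulVf ?mulr1//.
  by rewrite gt_eqF// wo.1.
pose u x := csum (fun n => p n x).
have lu : l1 omega u.
  apply: le_lt_trans sump; rewrite sumE; apply: le_esum => x _.
  rewrite mulrC EFinM.
  apply: (@le_trans _ _
      ((omega x)%:E * \esum_(n in [set: nat]) (normc (p n x))%:E)%E).
    by rewrite lee_wpmul2l ?lee_fin// normc_csum.
  rewrite -ge0_esumZ//; last by move=> n; rewrite lee_fin normc_ge0.
  by apply: le_esum => n _; rewrite -EFinM mulrC.
exists u => //.
have uh : conv u h = fun z => csum (fun n => p n.+1 z).
  apply/funext => z.
  transitivity (csum (fun y => csum (fun n => p n (z * y^-1)%g * h y))).
    congr csum; apply/funext => y; rewrite csumZr//.
    have := asumZ (h y) (sumx (z * y^-1)%g).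
    by congr asum; apply/funext => n; rewrite mulrC.
  rewrite csum_swap// esum_swap; last first.
    by move=> y n; rewrite lee_fin normc_ge0.
  (* Fubini's hypothesis: the inner sum for [n] is at most [q / omega z] times the norm of [p n],
     because [p n] is bounded by its norm divided by [omega]. *)
  apply: (@le_lt_trans _ _
      ((q / omega z)%:E * \esum_(n in [set: nat]) l1norm omega (p n))%E).
    rewrite -ge0_esumZ ?divr_ge0//; last by move=> n; exact: l1norm_ge0.
    apply: le_esum => n _.
    have pn0 : 0 <= fine (l1norm omega (p n)) by rewrite fine_ge0 ?l1norm_ge0.
    apply: le_trans (esum_conv_le _ _ _ _ z (l1_moderate _ wo _ pn0)
      (l1_bound _ _ wo (lp n))) _.
    by rewrite hq -[X in (_ <= _ * X)%E]fine_l1norm// -!EFinM lee_fin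
      [leLHS]mulrAC [leRHS]mulrAC [in leLHS](mulrC _ q).
  by rewrite lte_mul_pinfty// lee_fin divr_ge0.
have lh' : l1 omega (fun x => -1 * h x) by exact: l1Z.
rewrite (_ : (fun x => _) = fun x => delta1 x + -1 * h x); last first.
  by apply/funext => x; rewrite mulN1r.
rewrite (convDr omega)//; last exact: l1_delta1.
rewrite (convZr omega)// conv_delta1r uh; apply/funext => z.
by rewrite /u csum_recl// mulN1r addrK.
Qed.

(** * Point masses and the dual of [l1 omega] *)

Lemma l1_point_mass omega x k : (forall x, 0 <= omega x) ->
  l1 omega (point_mass x k).
Proof.
move=> o0; rewrite /l1 /= -/(l1norm omega (point_mass x k)).
by rewrite l1norm_point_mass// ltry.
Qed.

Lemma conv_point_mass x k f :
  conv (point_mass x k) f = fun z => k * f (x^-1 * z)%g.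
Proof.
apply/funext => z; rewrite /conv (csum_supp1 _ (x^-1 * z)%g).
  by rewrite invgM invgK mulVKg /point_mass eqxx.
move=> y yz; rewrite /point_mass (_ : _ == _ = false) ?mul0r//.
apply: contraNF yz => /eqP <-.
by rewrite invgM invgK mulgVK.
Qed.

(** [Rcomplex R] is [R[i]] as a real vector space: it carries the real Hahn-Banach theorem, while
    convolution stays complex. *)
Lemma Rcomplex_scaleE (t : R) (a : G -> Rcomplex R) :
  t *: a = (fun x => t%:C * a x) :> (G -> C).
Proof.
apply/funext => y; rewrite [LHS]/(t *: (a y : Rcomplex R)).
by case: (a y) => u v; simpc.
Qed.

Lemma Rcomplex_addE (a b : G -> Rcomplex R) :
  a + b = (fun x => (a x : C) + b x) :> (G -> C).
Proof. by []. Qed.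

Section DualOfL1.
Variables (omega : G -> R) (wo : weight omega).
Variable phi : (G -> Rcomplex R) -> R.
Hypothesis phiD : forall a b : G -> Rcomplex R, l1 omega a -> l1 omega b ->
  phi (a + b) = phi a + phi b.
Hypothesis phiZ : forall (t : R) (a : G -> Rcomplex R), l1 omega a ->
  phi (t *: a) = t * phi a.
Hypothesis phi_le : forall a, l1 omega a -> phi a <= fine (l1norm omega a).

Let o0 x : 0 <= omega x. Proof. by rewrite ltW ?wo.1. Qed.

Let phiN a : l1 omega a -> `|phi a| <= fine (l1norm omega a).
Proof.
move=> la; rewrite ler_norml phi_le// andbT lerNl -mulN1r -phiZ//.
rewrite Rcomplex_scaleE; apply: le_trans (phi_le _ _) _; first exact: l1Z.
by rewrite l1normZ// normcR normrN1 mul1e.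
Qed.

Let phi_fset a (s : seq G) : uniq s -> l1 omega a ->
  phi (fun x => if x \in s then a x else 0 : C) =
  \sum_(x <- s) phi (point_mass x (a x)).
Proof.
move=> + la; elim: s => [_|x s IHs /= /andP[xs us]].
  rewrite big_nil; have := phiZ 0 _ la.
  by rewrite scale0r mul0r => <-; congr phi.
rewrite big_cons -IHs// -phiD; last 2 first.
- exact: l1_point_mass.
- apply: le_lt_trans la; apply: le_esum => y _; rewrite lee_fin.
  by case: ifP => // _; rewrite normc0 mul0r mulr_ge0 ?normc_ge0.
rewrite Rcomplex_addE; congr phi; apply/funext => y; rewrite inE /point_mass.
have [->|yx] := eqVneq y x; first by rewrite (negPf xs) addr0.
by rewrite add0r.
Qed.

(** Continuity of [phi]: the error of a finite partial sum is [phi] of the rest [aC] of [a], bounded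
    by the norm of [aC], that is, by the tail of the norm series. A finite set good for the norm
    series is therefore good here. *)
Lemma dual_hsum a : l1 omega a ->
  hsum (fun x => (phi (point_mass x (a x)))%:C) (phi a)%:C.
Proof.
move=> la e e0.
have A0 x : 0 <= normc (a x) * omega x by rewrite mulr_ge0 ?normc_ge0.
have [A AB] := hsum_ge0 _ A0 la _ e0; exists A => B /AB.
rewrite -!rmorph_sum -!rmorphB !normcR => Be; apply: le_lt_trans Be.
pose aB x : C := if x \in (B : seq G) then a x else 0.
pose aC x : C := if x \in (B : seq G) then 0 else a x.
rewrite -(phi_fset a) ?fset_uniq// -/aB.
have laB : l1 omega aB.
  apply: le_lt_trans la; apply: le_esum => y _; rewrite lee_fin /aB.
  by case: ifP => // _; rewrite normc0 mul0r.
have laC : l1 omega aC.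
  apply: le_lt_trans la; apply: le_esum => y _; rewrite lee_fin /aC.
  by case: ifP => // _; rewrite normc0 mul0r.
have -> : phi a = phi aB + phi aC.
  rewrite -phiD// Rcomplex_addE; congr phi; apply/funext => x.
  by rewrite /aB /aC; case: ifP; rewrite ?addr0 ?add0r.
rewrite opprD addNKr normrN; apply: le_trans (phiN _ laC) _.
rewrite distrC; apply: le_trans _ (ler_norm _).
rewrite lerBrDr -lee_fin EFinD fine_l1norm//.
rewrite [leRHS](@esum_fine R G (fun x => normc (a x) * omega x))//.
rewrite (_ : \esum_(x in _) _ = l1norm omega aC + l1norm omega aB)%E.
  rewrite leeD2l//.
  rewrite (_ : \sum_(i <- B) _ = \sum_(i <- B) (normc (aB i) * omega i)).
    exact: ge0_esum_fset.
  by rewrite big_seq [RHS]big_seq; apply: eq_bigr => x xB; rewrite /aB xB.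
rewrite -ge0_esumD.
- apply: eq_esum => x _; rewrite /aB /aC.
  by case: ifP; rewrite normc0 mul0r ?addr0 ?add0r.
- by move=> x; rewrite mulr_ge0 ?normc_ge0.
- by move=> x; rewrite mulr_ge0 ?normc_ge0.
Qed.

(* The function of [linfty] representing the complexification
   [a |-> phi a - i * phi (i * a)] of [phi]. *)
Definition dual_fun x : C := ((omega x)^-1)%:C *
  ((phi (point_mass x 1))%:C - 'i%C * (phi (point_mass x 'i%C))%:C).

Lemma dual_fun_linfty : linfty R G dual_fun.
Proof.
(* Each of the two values of [phi] contributes at most [omega x]. *)
exists 2 => x; rewrite normcM normcR ger0_norm ?invr_ge0//.
rewrite ler_pdivrMl ?wo.1//; apply: le_trans (ler_normcD _ _) _.
rewrite normcN normcM !normcR.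
have h k : `|phi (point_mass x k)| <= normc k * omega x.
  apply: le_trans (phiN _ (l1_point_mass _ _ _ o0)) _.
  by rewrite l1norm_point_mass.
have ni : normc ('i%C : C) = 1 by rewrite /= expr0n expr1n add0r sqrtr1.
have := h 1; have := h 'i%C; rewrite ni normc1 !mul1r.
lra.
Qed.

(** Complex linearity of the complexification on the line of point masses at [x]: expand
    [k = r + i s] and [i k = - s + i r] and use real linearity of [phi]. *)
Lemma dual_funM x k : (omega x)%:C * dual_fun x * k =
  (phi (point_mass x k))%:C - 'i%C * (phi (point_mass x ('i%C * k)))%:C.
Proof.
rewrite /dual_fun mulrA -rmorphM mulfV ?mul1r; last by rewrite gt_eqF ?wo.1.
have phiE (r s : R) : phi (point_mass x (r +i* s)) =
    r * phi (point_mass x 1) + s * phi (point_mass x 'i%C).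
  have l1p k' := l1_point_mass _ x k' o0.
  have l1pZ (t : R) k' : l1 omega (t *: (point_mass x k' : G -> Rcomplex R)).
    by rewrite Rcomplex_scaleE; exact: l1Z.
  rewrite -!phiZ// -phiD// Rcomplex_addE !Rcomplex_scaleE.
  congr phi; apply/funext => y.
  by rewrite /point_mass; case: eqP => _; simpc.
case: k => r s.
rewrite (_ : 'i%C * (r +i* s) = (- s) +i* r); last by simpc.
rewrite (phiE r s) (phiE (- s) r).
move: (phi (point_mass x 1)) (phi (point_mass x 'i%C)) => p1 pi.
by apply/eqP; rewrite eq_complex /=; apply/andP; split; apply/eqP; ring.
Qed.

(** The adjoint relation tested on point masses: [omega x] times the value at [x] is the
    complexified [phi] at [conv (point_mass x 1) f], a left translate of [f]. Its two parts are
    [phi (b 1)] and [phi (b i)], both values on the ideal. *)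
Lemma rho_dual_fun f : l1 omega f ->
  (forall a, l1 omega a -> phi (conv a f) = 0) ->
  rho omega f dual_fun = fun _ => 0.
Proof.
move=> lf phi0; apply/funext => x.
pose b (k : C) z := k * f (x^-1 * z)%g.
have bE k : b k = conv (point_mass x k) f by rewrite conv_point_mass.
have lb k : l1 omega (b k) by rewrite bE; apply: l1_conv => //; exact: l1_point_mass.
have phib k : phi (b k) = 0 by rewrite bE; apply: phi0; exact: l1_point_mass.
pose v k z := (phi (point_mass z (b k z)))%:C : C.
have sv k : asum (v k).
  apply: le_lt_trans (lb k); apply: le_esum => z _.
  rewrite lee_fin /v normcR; apply: le_trans (phiN _ (l1_point_mass _ _ _ o0)) _.
  by rewrite l1norm_point_mass.
have cv k : csum (v k) = 0.
  by have := csum_hsum (dual_hsum _ (lb k)); rewrite phib.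
pose w z := ((omega x)^-1)%:C * (v 1 z + (- 'i%C) * v 'i%C z).
have sw : asum w by apply: asumZ; apply: asumD => //; exact: asumZ.
transitivity (csum w).
  rewrite /rho -(csum_reindex (fun y => x * y)%g (fun y => x^-1 * y)%g w)//.
  - congr csum; apply/funext => y.
    rewrite /w /v /b mul1r mulKg mulNr -dual_funM.
    by rewrite rmorphM -!mulrA [LHS]mulrCA.
  - exact: mulKg.
  - exact: mulVKg.
rewrite /w csumZ; last by apply: asumD => //; exact: asumZ.
by rewrite csumD ?csumZ ?cv ?mulr0 ?addr0 ?mulr0//; exact: asumZ.
Qed.

End DualOfL1.

(** * From injectivity to invertibility *)

Lemma rho_inj_approx_inverse omega f : weight omega -> l1 omega f ->
  set_inj (linfty R G) (rho omega f) ->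
  exists2 a, l1 omega a &
    (l1norm omega (fun x => (delta1 x - conv a f x)%R) < 1)%E.
Proof.
move=> wo lf finj; apply: contrapT => noa.
have o0 x : 0 <= omega x by rewrite ltW ?wo.1.
pose V := G -> Rcomplex R.
pose D : set V := l1 omega; pose W : set V := [set conv a f | a in l1 omega].
pose N (a : V) := fine (l1norm omega a).
have l10 : l1 omega (fun _ => 0).
  by rewrite /l1 /= -/(l1norm omega (fun=> 0)) l1norm0.
have D0 : D 0 by [].
have DD u v : D u -> D v -> D (u + v) by move=> Du Dv; exact: l1D.
have DZ (t : R) u : D u -> D (t *: u).
  by move=> Du; rewrite Rcomplex_scaleE; exact: l1Z.
have N0 u : D u -> 0 <= N u by move=> Du; rewrite fine_ge0// l1norm_ge0.
have NS : sublinear D N.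
  split=> [u v Du Dv|t u Du t0].
    rewrite -lee_fin EFinD !fine_l1norm//; last exact: DD.
    exact: l1normD.
  rewrite /N Rcomplex_scaleE l1normZ// normcR gtr0_norm// fineM//.
  by rewrite -fine_l1norm.
have WD : W `<=` D by move=> _ [a la <-]; exact: l1_conv.
have W0 : W 0.
  exists (fun=> 0) => //; apply/funext => z; rewrite /conv.
  by under eq_fun => y do rewrite mul0r; rewrite csum0.
have WA u v : W u -> W v -> W (u + v).
  move=> [a la <-] [b lb <-]; exists (fun x => a x + b x); first exact: l1D.
  by rewrite (convDl omega).
have WZ (t : R) u : W u -> W (t *: u).
  move=> [a la <-]; exists (fun x => t%:C * a x); first exact: l1Z.
  by rewrite Rcomplex_scaleE (convZl omega).
have Ddelta : D delta1 by exact: l1_delta1.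
(* The negated conclusion [noa] says exactly that [delta1] is at distance at least 1 from the ideal
   [W]. *)
have Ndelta w : W w -> 1 <= N ((delta1 : V) - w).
  move=> [a la <-]; rewrite leNgt; apply/negP => Na; apply: noa; exists a => //.
  rewrite -fine_l1norm ?lte_fin//.
  have := DD _ _ Ddelta (DZ (-1) _ (WD _ (ex_intro2 _ _ a la erefl))).
  by rewrite scaleN1r.
have [phi [phiD phiZ phi_le phiW phi1]] :=
  separation D D0 DD DZ N W (delta1 : V) NS N0 WD W0 WA WZ Ddelta Ndelta.
have phi0 a : l1 omega a -> phi (conv a f) = 0.
  by move=> la; apply: phiW; exists a.
pose g := dual_fun omega phi.
have g0 : g = fun=> 0.
  apply: finj.
  - by apply: mem_set; exact: dual_fun_linfty.
  - by apply: mem_set; exists 0 => x; rewrite normc0.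
  - rewrite rho_dual_fun//; apply/funext => x; rewrite /rho.
    by under [in RHS]eq_fun => y do rewrite mulr0 mul0r; rewrite csum0.
move/eqP: phi1; apply.
(* By [dual_funM], the real part of [omega 1 * g 1] is [phi delta1], which is nonzero although [g]
   is zero. *)
have := congr1 (fun z : C => complex.Re ((omega 1%g)%:C * z * 1))
  (congr1 (@^~ 1%g) g0).
rewrite [in LHS]/g dual_funM//.
rewrite -delta1E.
by rewrite mulr0 mul0r; simpc.
Qed.

Lemma approx_inverse_invertible omega f a : weight omega ->
  directly_finite omega -> l1 omega f -> l1 omega a ->
  (l1norm omega (fun x => (delta1 x - conv a f x)%R) < 1)%E ->
  l1_invertible omega f.
Proof.
move=> wo df lf la /(neumann _ _ wo)[u lu].
(* Here [h] is [delta1 - conv a f], so that [delta1 - h] is [conv a f] itself. *)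
rewrite (_ : (fun x => _) = conv a f); last first.
  by apply/funext => x; rewrite opprB addrC subrK.
rewrite -(conv_assoc_l1 omega)// => uaf.
have lua := l1_conv _ _ _ wo lu la.
by exists (conv u a) => //; split=> //; exact: df.
Qed.

End WeightedConvolution.

Theorem theorem8 (R : realType) (G : groupType) (omega : G -> R)
    (weight_omega : weight omega)
    (df_omega : directly_finite omega)
    (f : G -> R[i]) (l1_f : l1 omega f) :
  [<-> set_inj (linfty R G) (rho omega f);
       set_bij (linfty R G) (linfty R G) (rho omega f);
       l1_invertible omega f].
Proof.
(* Every arrow of the cycle below passes through this implication or [l1_invertible_rho_bij]; (i)
   reaches (ii) by way of (iii). *)
have inj_inv : set_inj (linfty R G) (rho omega f) -> l1_invertible omega f.
  move=> /(rho_inj_approx_inverse _ _ weight_omega l1_f)[a la a1].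
  exact: (approx_inverse_invertible _ _ a).
tfae.
- by move=> /inj_inv; exact: l1_invertible_rho_bij.
- by move=> /set_bij_inj; exact: inj_inv.
- by move=> /(l1_invertible_rho_bij _ _ weight_omega l1_f)/set_bij_inj.
Qed.
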